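(* Let $M$ be a complete metric space. The following are equivalent: (i) $M$ is a length space. (ii) $M$ is spreadingly local. (iii) $M$ is local.
   Context: A metric space $(M,d)$ is a length space if for every $x,y\in M$ the distance $d(x,y)$ equals the infimum of the lengths of rectifiable curves in $M$ joining $x$ and $y$. For a Lipschitz function $f\colon M\to\mathbb R$, $\|f\|_L$ denotes its Lipschitz constant $\sup\{|f(x)-f(y)|/d(x,y):x\neq y\in M\}$, and $B(x,\delta)$ is the closed ball of center $x$ and radius $\delta$. $M$ is local if for every $\varepsilon>0$ and every Lipschitz function $f\colon M\to\mathbb R$ there exist $u\neq v\in M$ such that $d(u,v)<\varepsilon$ and $\frac{f(u)-f(v)}{d(u,v)}>\|f\|_L-\varepsilon$. $M$ is spreadingly local if for every $\varepsilon>0$ and every Lipschitz function $f\colon M\to\mathbb R$ the set $\{x\in M:\inf_{\delta>0}\|f|_{B(x,\delta)}\|_L>\|f\|_L-\varepsilon\}$ is infinite.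
   Formalization: The formal statement assumes that M has at least two distinct points; a one-point (or empty) space is a complete length space but is neither local nor spreadingly local, so the equivalence fails there. *)

(* Defs.v *)
From HB Require Import structures.
From mathcomp Require Export all_boot all_order all_algebra.
From mathcomp Require Export all_classical all_reals all_analysis.

Set Implicit Arguments.
Unset Strict Implicit.
Unset Printing Implicit Defensive.

Export Order.TTheory GRing.Theory Num.Theory.
Export numFieldNormedType.Exports.

Local Open Scope classical_set_scope.
Local Open Scope ring_scope.

#[short(type="completeMetricType")]
HB.structure Definition CompleteMetric (R : numDomainType) :=
  {M of Complete M & Metric R M}.

Section Curves.
Context {R : realType} {M : metricType R}.

(* The analogue of [variation] for curves with values in a metric space. *)
Definition polygonal_length (a b : R) (gamma : R -> M) (s : seq R) : R :=
  let F := gamma \o nth b (a :: s) in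
  \sum_(0 <= n < size s) mdist (F n) (F n.+1).

Definition curve_length (a b : R) (gamma : R -> M) : \bar R :=
  ereal_sup [set (polygonal_length a b gamma s)%:E |
             s in itv_partition a b].

(* A curve [0, 1] -> M is represented by a total function on R, of which only
   the restriction to [0, 1] matters. *)
Definition rectifiable_curve (x y : M) (gamma : R -> M) : Prop :=
  [/\ {within `[0, 1], continuous gamma}, gamma 0 = x, gamma 1 = y &
      (curve_length 0 1 gamma < +oo)%E].

End Curves.

(* The infimum is taken in \bar R, so it is +oo when no rectifiable curve joins
   x and y; the equality thus includes the existence of such a curve. *)
Definition length_space {R : realType} (M : metricType R) : Prop :=
  forall x y : M, (mdist x y)%:E =
    ereal_inf [set curve_length 0 1 gamma | gamma in rectifiable_curve x y].

Section Lipschitz.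
Context {R : realType} {M : metricType R}.
Implicit Types (f : M -> R) (A : set M).

Definition lipschitz_map f : Prop :=
  exists k : R, forall x y, `|f x - f y| <= k * mdist x y.

(* [sup] is meaningful here when f is Lipschitz; as [sup set0 = 0], the
   Lipschitz constant on a set with at most one point is 0. *)
Definition lipschitz_const_on A f : R :=
  sup [set r | exists x y, [/\ A x, A y, x <> y &
                               r = `|f x - f y| / mdist x y]].

Definition lipschitz_const f : R := lipschitz_const_on setT f.

(* The library's [closed_ball] is the closure of the open ball, which in a
   general metric space may be smaller. *)
Definition metric_closed_ball (x : M) (delta : R) : set M :=
  [set y | mdist x y <= delta].

Definition local_lipschitz_const f (x : M) : R :=
  inf [set lipschitz_const_on (metric_closed_ball x delta) f |
       delta in [set delta : R | 0 < delta]].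

End Lipschitz.

Definition local_space {R : realType} (M : metricType R) : Prop :=
  forall (eps : R) (f : M -> R), 0 < eps -> lipschitz_map f ->
    exists u v : M, [/\ u <> v, mdist u v < eps &
      (f u - f v) / mdist u v > lipschitz_const f - eps].

Definition spreadingly_local {R : realType} (M : metricType R) : Prop :=
  forall (eps : R) (f : M -> R), 0 < eps -> lipschitz_map f ->
    infinite_set
      [set x | local_lipschitz_const f x > lipschitz_const f - eps].

(* Main.v *)
(* For complete spaces, being a length space amounts to having approximate
   midpoints: iterating them along the dyadic numbers, with summable errors,
   gives Lipschitz curves of almost minimal length.  If x and y have no
   approximate midpoint, the difference of two tents of slope l < 1, centered at
   x and y and of radius a bit more than d(x, y) / 2, has Lipschitz constant at
   least 1 but slope at most l between nearby points, so M is not local.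
   Conversely, in a length space a function which is c-Lipschitz near all but
   finitely many points is c-Lipschitz: integrate along almost minimal curves,
   after flattening the function near its exceptional values. *)
Require Import Defs.
From mathcomp Require Import ring lra.

Set Implicit Arguments.
Unset Strict Implicit.
Unset Printing Implicit Defensive.

Local Open Scope classical_set_scope.
Local Open Scope ring_scope.

Section ApproximateMidpoints.
Context {R : realType}.

Definition approximate_midpoints (M : metricType R) : Prop :=
  forall (x y : M) (e : R), 0 < e ->
  exists z, mdist x z <= mdist x y / 2 + e /\ mdist z y <= mdist x y / 2 + e.

(** * Lipschitz constants on sets and near points *)

Section LipschitzConst.
Context {M : metricType R}.
Implicit Types (f : M -> R) (A : set M).

Lemma metric_dist_diff (x u v : M) : `|mdist x u - mdist x v| <= mdist u v.
Proof.
have := metric_triangle x u v; have := metric_triangle x v u.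
rewrite (metric_sym v u) => h1 h2.
by rewrite ler_norml; lra.
Qed.

Lemma lipschitz_slopes_ubound A f : lipschitz_map f ->
  has_ubound [set r | exists x y, [/\ A x, A y, x <> y &
                                    r = `|f x - f y| / mdist x y]].
Proof.
move=> [k fk]; exists k => _ [x [y [_ _ xy ->]]].
by rewrite ler_pdivrMr ?fk// mdist_gt0; apply/eqP.
Qed.

Lemma lipschitz_const_on_le A f x y : lipschitz_map f -> A x -> A y ->
  `|f x - f y| <= lipschitz_const_on A f * mdist x y.
Proof.
move=> lf Ax Ay; have [->|/eqP xy] := eqVneq x y.
  by rewrite subrr normr0 mdistxx mulr0.
rewrite -ler_pdivrMr; last by rewrite mdist_gt0; apply/eqP.
by apply: ub_le_sup; [exact: lipschitz_slopes_ubound|exists x, y].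
Qed.

Lemma lipschitz_const_on_ge0 A f : lipschitz_map f ->
  0 <= lipschitz_const_on A f.
Proof.
move=> lf; have [[r Er]|E0] := pselect ([set r | exists x y,
    [/\ A x, A y, x <> y & r = `|f x - f y| / mdist x y]] !=set0).
  have := ub_le_sup (lipschitz_slopes_ubound A lf) Er; apply: le_trans.
  by case: Er => x [y [_ _ _ ->]]; rewrite divr_ge0// mdist_ge0.
rewrite /lipschitz_const_on; have /nonemptyPn -> := E0.
by rewrite sup0.
Qed.

Lemma lipschitz_const_on_gtP A f c : 0 <= c -> c < lipschitz_const_on A f ->
  exists u v, [/\ A u, A v, u <> v & c < (f u - f v) / mdist u v].
Proof.
(* An empty set of slopes has supremum 0 by default, which [c0] excludes. *)
move=> c0 cA; have [E0|/nonemptyPn E0] := pselect ([set r | exists x y,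
    [/\ A x, A y, x <> y & r = `|f x - f y| / mdist x y]] !=set0); last first.
  by move: cA; rewrite /lipschitz_const_on E0 sup0 ltNge c0.
have [_ [x [y [Ax Ay xy ->]]]] := sup_gt E0 cA.
have [_|_] := ger0P (f x - f y); first by exists x, y.
by rewrite opprB metric_sym; exists y, x; split=> //; exact: nesym.
Qed.

(** Two distinct points make the set of slopes nonempty; otherwise its supremum is the default 0,
    which exceeds a negative [c]. *)
Lemma lipschitz_const_le f c : (exists x y : M, x <> y) ->
  (forall u v, `|f u - f v| <= c * mdist u v) -> lipschitz_const f <= c.
Proof.
move=> [x [y xy]] fc; apply: ge_sup.
  by exists (`|f x - f y| / mdist x y), x, y.
move=> _ [u [v [_ _ uv ->]]].
by rewrite ler_pdivrMr ?fc// mdist_gt0; apply/eqP.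
Qed.

Lemma local_lipschitz_const_ge0 f x : lipschitz_map f ->
  0 <= local_lipschitz_const f x.
Proof.
move=> lf; apply: lb_le_inf => [|_ [d _ <-]]; last first.
  exact: lipschitz_const_on_ge0.
by eexists; exists 1 => /=.
Qed.

Lemma local_lipschitz_const_le f x d : lipschitz_map f -> 0 < d ->
  local_lipschitz_const f x <= lipschitz_const_on (metric_closed_ball x d) f.
Proof.
move=> lf d0; apply: ge_inf; last by exists d.
by exists 0 => _ [e _ <-]; exact: lipschitz_const_on_ge0.
Qed.

(** In this form the property passes at once to any function whose increments are dominated by those
    of [f]. *)
Definition lipschitz_near (c : R) f (x : M) : Prop :=
  exists2 d, 0 < d & forall u v, mdist x u <= d -> mdist x v <= d ->
    `|f u - f v| <= c * mdist u v.

Lemma lipschitz_nearP c f x : lipschitz_map f ->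
  local_lipschitz_const f x < c ->
  lipschitz_near c f x.
Proof.
move=> lf /inf_lt[|_ [d /= d0 <-] dc].
  by eexists; exists 1 => /=.
exists d => // u v xu xv.
have := lipschitz_const_on_le lf (xu : metric_closed_ball x d u) xv.
by move=> /le_trans; apply; rewrite ler_wpM2r ?mdist_ge0// ltW.
Qed.

End LipschitzConst.

(** * Local spaces have approximate midpoints *)

Lemma local_space_midpoints (M : metricType R) :
  local_space M -> approximate_midpoints M.
Proof.
move=> Mloc x y e e0; apply: contrapT => nz.
have d0 := mdist_ge0 x y.
have er : e < mdist x y / 2.
  rewrite ltNge; apply/negP => h; apply: nz; exists x; rewrite mdistxx.
  by split; lra.
set r := mdist x y / 2 in er nz.
(* A tent of height [r] and slope [l] reaches 0 exactly at distance [r + e / 2], which is less than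
   [mdist x y] by [er]. *)
pose l := r / (r + e / 2).
have l1 : l < 1 by rewrite ltr_pdivrMr; lra.
have l0 : 0 < l by rewrite divr_gt0; lra.
have lE : l * (r + e / 2) = r by rewrite divfK//; lra.
pose tent (z t : M) : R := Num.max (r - l * mdist z t) 0.
have tent_lip (z u v : M) : tent z u - tent z v <= l * mdist u v.
  have h : l * mdist z v <= l * mdist z u + l * mdist u v.
    by rewrite -mulrDr (ler_wpM2l (ltW l0))// metric_triangle.
  have h0 : 0 <= l * mdist u v by rewrite mulr_ge0 ?mdist_ge0// ltW.
  by rewrite /tent; case: (lerP (r - l * mdist z u) 0);
    case: (lerP (r - l * mdist z v) 0); lra.
have tent_ge0 (z t : M) : 0 <= tent z t by rewrite le_max lexx orbT.
have tent_far (z t : M) : r + e / 2 <= mdist z t -> tent z t = 0.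
  move=> h; apply/max_idPr; rewrite subr_le0 -{1}lE.
  by apply: ler_wpM2l => //; exact: ltW.
pose f (t : M) : R := tent x t - tent y t.
have lf : lipschitz_map f.
  exists (l + l) => u v; rewrite /f ler_norml mulrDl.
  have := tent_lip x u v; have := tent_lip x v u.
  have := tent_lip y u v; have := tent_lip y v u.
  by rewrite (metric_sym v u); lra.
have xy2 : mdist x y = r + r by rewrite /r; lra.
have K1 : 1 <= lipschitz_const f.
  have := lipschitz_const_on_le lf (I : setT x) (I : setT y).
  have -> : f x - f y = mdist x y.
    rewrite /f (tent_far x y) ?(tent_far y x) ?(metric_sym y x); try lra.
    by rewrite /tent !mdistxx mulr0 subr0 (max_idPl _) ?xy2; lra.
  rewrite ger0_norm// -{1}[mdist x y]mul1r ler_pM2r//; lra.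
(* The entry [1 - l] forces a slope above [l]; the entry [e / 2] is the error allowed when passing
   from [v] to [u] at the end. *)
have e'0 : 0 < Num.min (e / 2) (1 - l).
  by rewrite lt_min; apply/andP; split; lra.
have [u [v [uv]]] := Mloc _ _ e'0 lf.
rewrite lt_min => /andP[uve _] slope.
have duv : 0 < mdist u v by rewrite mdist_gt0; apply/eqP.
have {slope} : l < (f u - f v) / mdist u v.
  apply: le_lt_trans slope; have : Num.min (e / 2) (1 - l) <= 1 - l.
    by rewrite ge_min lexx orbT.
  lra.
rewrite ltr_pdivlMr// /f => slope.
have fxu := tent_ge0 x u; have fyv := tent_ge0 y v.
have fyu := tent_ge0 y u; have fxv := tent_ge0 x v.
(* If [tent x u] vanished, [f u - f v] would be at most [tent y v - tent y u], hence at most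
   [l * mdist u v], against [slope]. The case of [v] and [y] is symmetric. *)
have xu : mdist x u < r + e / 2.
  rewrite ltNge; apply/negP => /tent_far h.
  by have := tent_lip y v u; rewrite (metric_sym v u); lra.
have yv : mdist y v < r + e / 2.
  rewrite ltNge; apply/negP => /tent_far h.
  by have := tent_lip x u v; lra.
apply: nz; exists u; split; first lra.
have := metric_triangle u v y; rewrite (metric_sym v y); lra.
Qed.

(** * Almost minimal Lipschitz curves from approximate midpoints *)

Definition lipschitz_curve {M : metricType R} (L : R) (g : R -> M) : Prop :=
  forall s t, 0 <= s -> s <= t -> mdist (g s) (g t) <= L * (t - s).

Section DyadicCurve.
Variables (M : completeMetricType R) (x y : M) (e : R).
Hypothesis e0 : 0 < e.
Variable mid : nat -> M -> M -> M.
Hypothesis midP : forall n u v,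
  mdist u (mid n u v) <= mdist u v / 2 + e / 4 ^+ n.+1 /\
  mdist (mid n u v) v <= mdist u v / 2 + e / 4 ^+ n.+1.

(** The value intended for the curve at k / 2^n. Indices beyond 2^n are allowed too, so that the
    step estimate needs no bound on k. *)
Fixpoint dyadic_point (n k : nat) : M :=
  if n is n'.+1 then
    let u := dyadic_point n' k./2 in
    if odd k then mid n' u (dyadic_point n' k./2.+1) else u
  else if k is 0 then x else y.

Let L := mdist x y + e.

Lemma dyadic_point0 n : dyadic_point n 0 = x.
Proof. by elim: n. Qed.

Lemma dyadic_point1 n : dyadic_point n (2 ^ n) = y.
Proof. by elim: n => //= n IH; rewrite expnS mul2n odd_double doubleK. Qed.

(* The slack e/4^(n+1) spent at level n is multiplied by 2^(n+1) intervals, so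
   the total over all levels stays below e. *)
Lemma dyadic_point_step n k :
  mdist (dyadic_point n k) (dyadic_point n k.+1) <= L / 2 ^+ n.
Proof.
(* [b] records the slack already spent; since b (n+1) = b n / 2 + e / 4^(n+1) exactly, the induction
   closes. *)
pose b m : R := (mdist x y + e * (1 - (2 ^+ m)^-1)) / 2 ^+ m.
suff : mdist (dyadic_point n k) (dyadic_point n k.+1) <= b n.
  move=> /le_trans; apply; rewrite ler_pM2r ?invr_gt0 ?exprn_gt0//.
  by rewrite lerD2l ler_piMr ?ltW// gerBl invr_ge0 exprn_ge0.
elim: n k => [|n IH] k.
  rewrite /b /= expr0 invr1 subrr mulr0 addr0 mulr1.
  by case: k => [//|k]; rewrite mdistxx mdist_ge0.
have main : b n / 2 + e / 4 ^+ n.+1 <= b n.+1.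
  have p0 : 2 ^+ n != 0 :> R by rewrite expf_neq0.
  have -> : 4 ^+ n.+1 = (2 ^+ n * 2) ^+ 2 :> R.
    by rewrite -exprSr -exprM mulnC exprM; congr (_ ^+ _); ring.
  suff -> : b n.+1 = b n / 2 + e / (2 ^+ n * 2) ^+ 2 by [].
  by rewrite /b exprSr; field.
apply: le_trans main; rewrite /=.
have [mk1 mk2] := midP n (dyadic_point n k./2) (dyadic_point n k./2.+1).
rewrite uphalf_half; case: (odd k) => /=.
  by apply: le_trans mk2 _; rewrite lerD2r ler_pM2r.
by apply: le_trans mk1 _; rewrite lerD2r ler_pM2r.
Qed.

Lemma dyadic_point_lipschitz n j k : (j <= k)%N ->
  mdist (dyadic_point n j) (dyadic_point n k) <= L / 2 ^+ n * (k - j)%:R.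
Proof.
move=> /subnK <-; rewrite addnK; elim: (k - j)%N => [|m IH].
  by rewrite mdistxx mulr0.
rewrite addSn -[m.+1%:R]natr1 mulrDr mulr1.
apply: le_trans (metric_triangle _ (dyadic_point n (m + j)) _) _.
by rewrite lerD// dyadic_point_step.
Qed.

(** A step function on the grid of mesh 2^-n; its jumps, at most [L / 2 ^+ n], vanish in the
    limit. *)
Let g n (t : R) := dyadic_point n (Num.truncn (t * 2 ^+ n)).

Let L0 : 0 <= L.
Proof. by rewrite addr_ge0 ?mdist_ge0 ?ltW. Qed.

(** The point of level n reappears at level n + 1 with the index of [t] rounded down to an even one,
    so the two points are equal or adjacent there. *)
Lemma dyadic_step_cauchy n t : 0 <= t ->
  mdist (g n t) (g n.+1 t) <= L / 2 ^+ n.+1.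
Proof.
move=> t0; set k := Num.truncn (t * 2 ^+ n.+1).
have -> : g n t = dyadic_point n.+1 (k./2.*2).
  rewrite /g /= odd_double doubleK; congr dyadic_point.
  have /truncn_itv : 0 <= t * 2 ^+ n.+1 by rewrite mulr_ge0// exprn_ge0.
  rewrite -/k => /andP[h1 h2]; apply: truncn_def.
  rewrite exprSr mulrA in h1 h2.
  have kE : (k = odd k + k./2 + k./2)%N by rewrite -addnA addnn odd_double_half.
  move: h1 h2; rewrite {1 2}kE -[_.+1%:R]natr1 -[k./2.+1%:R]natr1 !natrD.
  by case: (odd k) => /= h1 h2; apply/andP; split; lra.
rewrite /g -/k -{2}(odd_double_half k); case: (odd k); rewrite ?add1n ?add0n.
  exact: dyadic_point_step.
by rewrite mdistxx divr_ge0// exprn_ge0.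
Qed.

Lemma dyadic_step_dist n m t : 0 <= t -> (n <= m)%N ->
  mdist (g n t) (g m t) <= L / 2 ^+ n - L / 2 ^+ m.
Proof.
move=> t0 /subnK <-; elim: (m - n)%N => [|j IH].
  by rewrite subrr mdistxx.
rewrite addSn; apply: le_trans (metric_triangle _ (g (j + n) t) _) _.
apply: le_trans (lerD IH (dyadic_step_cauchy _ t0)) _.
have p0 : 2 ^+ (j + n) != 0 :> R by rewrite expf_neq0.
rewrite exprSr le_eqVlt; apply/orP; left; apply/eqP.
by field; rewrite p0 expf_neq0.
Qed.

(** Rounding [s] and [t] down to the grid adds at most one step to the (t - s) 2^n expected ones. *)
Lemma dyadic_step_lipschitz n s t : 0 <= s -> s <= t ->
  mdist (g n s) (g n t) <= L * (t - s) + L / 2 ^+ n.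
Proof.
move=> s0 st; have p0 : 0 < 2 ^+ n :> R by rewrite exprn_gt0.
have st' : s * 2 ^+ n <= t * 2 ^+ n by rewrite ler_pM2r.
have jk := le_truncn st'.
apply: le_trans (dyadic_point_lipschitz n jk) _; rewrite natrB//.
have /truncn_itv/andP[_] : 0 <= s * 2 ^+ n := mulr_ge0 s0 (ltW p0).
have /truncn_itv/andP[] : 0 <= t * 2 ^+ n := mulr_ge0 (le_trans s0 st) (ltW p0).
set k := Num.truncn (t * _); set j := Num.truncn (s * _) => h1 _.
rewrite -[j.+1%:R]natr1 => h2.
have -> : L * (t - s) + L / 2 ^+ n = L / 2 ^+ n * ((t - s) * 2 ^+ n + 1).
  by field; rewrite gt_eqF.
by rewrite ler_wpM2l ?divr_ge0 ?(ltW p0)//; lra.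
Qed.

Lemma dyadic_curve :
  exists g : R -> M, [/\ g 0 = x, g 1 = y & lipschitz_curve L g].
Proof.
have small d : 0 < d -> exists n, L / 2 ^+ n < d.
  move=> d0; exists (Num.bound (L / d)).
  rewrite ltr_pdivrMr ?exprn_gt0// mulrC -ltr_pdivrMr//.
  exact: upper_nthrootP.
have cvgg t : 0 <= t -> cvg (g ^~ t @ \oo).
  move=> t0; apply/cauchy_cvgP/cauchyP => d d0; have [n nd] := small _ d0.
  exists (g n t); exists n => // m /= nm; rewrite ballEmdist /=.
  apply: le_lt_trans (dyadic_step_dist t0 nm) _.
  by apply: le_lt_trans nd; rewrite gerBl divr_ge0// exprn_ge0.
pose h t := lim (g ^~ t @ \oo).
have hg d t : 0 <= t -> 0 < d -> \forall n \near \oo, mdist (h t) (g n t) < d.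
  move=> t0 d0; have [n _ nE] := cvg_ball (cvgg _ t0) d0.
  by exists n => // m /nE; rewrite /= ballEmdist.
(* Used at times 0 and 1, which lie on every grid: all approximations agree there, so the endpoints
   are exact. *)
have h_cst t z : 0 <= t -> (forall n, g n t = z) -> h t = z.
  move=> t0 gz; apply/eqP; rewrite eq_sym -[_ == _]negbK -mdist_gt0 -leNgt.
  apply/ler_addgt0Pl => d d0; rewrite addr0 metric_sym.
  by have [n _ /(_ n (leqnn _))] := hg _ _ t0 d0; rewrite /= gz => /ltW.
exists h; split.
- by apply: h_cst => // n; rewrite /g mul0r truncn0 dyadic_point0.
- by apply: h_cst => // n; rewrite /g mul1r -natrX natrK dyadic_point1.
move=> s t s0 st; have t0 := le_trans s0 st.
(* One third for each of the two limits, one for the rounding term [L / 2 ^+ n]. *)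
apply/ler_addgt0Pl => d d0; have d3 : 0 < d / 3 by rewrite divr_gt0.
have [N NE] := small _ d3.
have near_small : \forall n \near \oo, L / 2 ^+ n < d / 3.
  exists N => // n /= Nn; apply: le_lt_trans NE.
  by rewrite ler_wpM2l// lef_pV2 ?posrE ?exprn_gt0// ler_weXn2l// ler1n.
near \oo => n.
have hs : mdist (h s) (g n s) < d / 3 by near: n; exact: hg.
have ht : mdist (h t) (g n t) < d / 3 by near: n; exact: hg.
have Ln : L / 2 ^+ n < d / 3 by near: n; exact: near_small.
have := dyadic_step_lipschitz n s0 st.
have := metric_triangle (h s) (g n s) (h t).
have := metric_triangle (g n s) (g n t) (h t).
rewrite (metric_sym (g n t)); lra.
Unshelve. all: by end_near. Qed.

End DyadicCurve.

Lemma midpoints_lipschitz_curve (M : completeMetricType R) (x y : M) (e : R) :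
  approximate_midpoints M -> 0 < e ->
  exists g : R -> M,
    [/\ g 0 = x, g 1 = y & lipschitz_curve (mdist x y + e) g].
Proof.
move=> Mmid e0.
have step0 n : 0 < e / 4 ^+ n.+1 by rewrite divr_gt0// exprn_gt0.
pose mid n u v := projT1 (cid (Mmid u v _ (step0 n))).
apply: (@dyadic_curve M x y e e0 mid).
by move=> n u v; rewrite /mid; case: cid.
Qed.

(** * Length of curves; length spaces and approximate midpoints *)

Lemma lipschitz_curve_continuous (M : metricType R) (L : R) (g : R -> M) :
  0 < L -> lipschitz_curve L g -> {within `[0, 1], continuous g}.
Proof.
move=> L0 gL; apply/subspace_continuousP => s /=.
rewrite in_itv/= => /andP[s0 _]; apply/cvg_ballP => d d0.
rewrite ballEmdist /= near_withinE.
exists (d / L) => /=; first exact: divr_gt0.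
move=> t /= st; rewrite in_itv/= => /andP[t0 _].
have {}st : L * `|s - t| < d by rewrite mulrC -ltr_pdivlMr.
apply: le_lt_trans st.
have [le_st|lt_ts] := leP s t; first by rewrite ler0_norm ?subr_le0// opprB gL.
by rewrite metric_sym gtr0_norm ?subr_gt0// gL// ltW.
Qed.

Lemma lipschitz_curve_length (M : metricType R) (L : R) (g : R -> M) :
  lipschitz_curve L g -> (curve_length 0 1 g <= L%:E)%E.
Proof.
move=> gL; apply: ge_ereal_sup => _ [s ps <-]; rewrite lee_fin.
pose t n := nth 1 (0 :: s) n.
have tS n : (n < size s)%N -> t n <= t n.+1.
  move=> ns; apply: (nondecreasing_fun_itv_partition (f := id) _ ps ns).
  by move=> ? ? _ _.
apply: (@le_trans _ _ (\sum_(0 <= n < size s) (L * t n.+1 - L * t n))).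
  rewrite /polygonal_length !big_nat; apply: ler_sum => n /andP[_ ns].
  rewrite -mulrBr; apply: gL; last exact: tS.
  by apply: (itv_partition_nth_ge _ ps); rewrite ltnW.
rewrite telescope_sumr// -mulrBr /t (itv_partition_nth_size 1 ps).
by rewrite /= subr0 mulr1.
Qed.

(** At t = 0 this bounds the length below by the distance of the endpoints; at an intermediate t it
    splits an almost minimal curve. *)
Lemma mdist_add_le_curve_length (M : metricType R) (g : R -> M) (t : R) :
  t \in `[0, 1] ->
  ((mdist (g 0) (g t) + mdist (g t) (g 1))%:E <= curve_length 0 1 g)%E.
Proof.
have le_d : ((mdist (g 0) (g 1))%:E <= curve_length 0 1 g)%E.
  apply: ereal_sup_ubound; exists [:: 1]; first exact: itv_partition1.
  by rewrite /polygonal_length /= big_nat1.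
rewrite in_itv/= (le_eqVlt 0 t) (le_eqVlt t 1).
(* Partition points increase strictly, so [[:: t; 1]] serves only for 0 < t < 1; the two endpoints
   reduce to [le_d]. *)
move=> /andP[/predU1P[<- _|t0 /predU1P[->|t1]]].
- by rewrite mdistxx add0r.
- by rewrite mdistxx addr0.
apply: ereal_sup_ubound; exists [:: t; 1] => /=; last first.
  by rewrite /polygonal_length /= big_nat_recr//= big_nat1.
by split=> /=; rewrite ?t0 ?t1.
Qed.

Lemma midpoints_length_space (M : completeMetricType R) :
  approximate_midpoints M -> length_space M.
Proof.
move=> Mmid x y; apply/eqP; rewrite eq_le; apply/andP; split.
  apply: le_ereal_inf_tmp => _ [g [_ <- <- _] <-].
  have := @mdist_add_le_curve_length M g 0; rewrite mdistxx add0r; apply.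
  by rewrite in_itv/= lexx ler01.
apply/lee_addgt0Pr => e e0.
have [g [g0 g1 gL]] := midpoints_lipschitz_curve x y Mmid e0.
have gl := lipschitz_curve_length gL.
rewrite -EFinD; apply: (le_trans _ gl); apply: ereal_inf_lbound.
exists g => //; split=> //; last by apply: le_lt_trans gl _; rewrite ltry.
by apply: lipschitz_curve_continuous gL; rewrite ltr_wpDl ?mdist_ge0.
Qed.

(** By the intermediate value theorem, a curve of length below [mdist x y + e] has a point at
    distance exactly [mdist x y / 2] from [x]; what remains of the length bounds its distance to
    [y]. *)
Lemma length_space_midpoints (M : metricType R) :
  length_space M -> approximate_midpoints M.
Proof.
move=> Mlen x y e e0.
have : (ereal_inf [set curve_length 0 1 g | g in rectifiable_curve x y] <
        (mdist x y + e)%:E)%E by rewrite -Mlen lte_fin ltrDl.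
move=> /ereal_inf_lt[_ [g [gc g0 g1 _] <-] gl].
have cf : {within `[0, 1], continuous (fun t => mdist x (g t))}.
  apply/subspace_continuousP => s s01.
  have /subspace_continuousP/(_ s s01)/cvg_ballP gs := gc.
  apply/cvgrPdist_lt => d d0; have := gs d d0.
  rewrite ballEmdist /=; apply: filterS => t.
  by apply: le_lt_trans; exact: metric_dist_diff.
have d0 := mdist_ge0 x y.
have [] := @IVT R _ 0 1 (mdist x y / 2) ler01 cf.
  rewrite g0 g1 mdistxx (min_idPl _)// (max_idPr _)//.
  by apply/andP; split; lra.
move=> t t01 xt; exists (g t).
have := le_lt_trans (mdist_add_le_curve_length g t01) gl.
by rewrite g0 g1 lte_fin; split; lra.
Qed.

(** * From local to global Lipschitz bounds *)

Lemma locally_bounded_slope (h : R -> R) (C : R) :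
  (forall t, 0 <= t <= 1 -> exists2 d, 0 < d & forall s, 0 <= s <= 1 ->
     `|s - t| < d -> `|h s - h t| <= C * `|s - t|) ->
  `|h 1 - h 0| <= C.
Proof.
(* Continuous induction: the local estimate at [sup A] puts [sup A] into [A], and then a larger
   point as well unless [sup A] is 1. *)
move=> hC; pose A := [set t | 0 <= t <= 1 /\ `|h t - h 0| <= C * t].
have A0 : A 0 by rewrite /A /= lexx ler01 subrr normr0 mulr0.
have uA : has_ubound A by exists 1 => t [/andP[]].
have supA : has_sup A by split => //; exists 0.
have s01 : 0 <= sup A <= 1.
  rewrite (ub_le_sup uA A0) /=.
  by apply: ge_sup; [exists 0|move=> t [/andP[]]].
have [d d0 hd] := hC _ s01; case/andP: (s01) => s0 s1.
have [t At tl] := sup_adherent d0 supA.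
have tA := ub_le_sup uA At.
have As : A (sup A).
  split=> //; case: At => t01 ht.
  have := hd t t01; rewrite ler0_norm ?subr_le0// => /(_ ltac:(lra)).
  move: ht; rewrite !ler_norml => /andP[h1 h2] /andP[h3 h4].
  by apply/andP; split; lra.
suff sA : sup A = 1 by have [_] := As; rewrite sA mulr1.
apply/eqP; rewrite eq_le s1 /= leNgt; apply/negP => sA1.
pose u := Num.min 1 (sup A + d / 2).
have su : sup A < u by rewrite lt_min sA1 ltrDl divr_gt0.
have u1 : u <= 1 by rewrite ge_min lexx.
have ud : u <= sup A + d / 2 by rewrite ge_min lexx orbT.
have u01 : 0 <= u <= 1 by apply/andP; split; lra.
suff /(ub_le_sup uA) : A u by rewrite leNgt su.
split=> //; have := hd u u01.
rewrite ger0_norm ?subr_ge0 ?(ltW su)// => /(_ ltac:(lra)).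
have [_] := As; rewrite !ler_norml => /andP[h1 h2] /andP[h3 h4].
by apply/andP; split; lra.
Qed.

Lemma lipschitz_near_midpoints (M : completeMetricType R) (c : R) (f : M -> R) :
  approximate_midpoints M -> 0 <= c -> (forall x, lipschitz_near c f x) ->
  forall x y, `|f x - f y| <= c * mdist x y.
Proof.
move=> Mmid c0 fc x y.
have [->|xy] := eqVneq x y; first by rewrite subrr normr0 mdistxx mulr0.
apply/ler_addgt0Pl => e e0.
have c10 : 0 < c + 1 by rewrite ltr_wpDl.
(* An excess length of e / (c + 1) costs c e / (c + 1) <= e; adding 1 covers c = 0. *)
have e'0 : 0 < e / (c + 1) by rewrite divr_gt0.
have [g [gx gy gL]] := midpoints_lipschitz_curve x y Mmid e'0.
set L := mdist x y + _ in gL.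
have L0 : 0 < L by rewrite ltr_wpDl// mdist_ge0.
have g_dist s t : 0 <= s -> 0 <= t -> mdist (g t) (g s) <= L * `|s - t|.
  move=> s0 t0; have [st|ts] := ler0P (s - t).
    by rewrite metric_sym opprB gL// -subr_le0.
  by rewrite gL// -subr_ge0 ltW.
have : `|f (g 1) - f (g 0)| <= c * L.
  apply: (@locally_bounded_slope (f \o g)) => t /andP[t0 _].
  have [d d0 fd] := fc (g t); exists (d / L); first exact: divr_gt0.
  move=> s /andP[s0 _]; rewrite ltr_pdivlMr// mulrC => std.
  have gst := g_dist _ _ s0 t0.
  apply: le_trans (fd _ _ _ _) _ => /=.
  - by apply: le_trans gst (ltW std).
  - by rewrite mdistxx ltW.
  - by rewrite -mulrA ler_wpM2l// metric_sym.
rewrite gx gy distrC => /le_trans; apply.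
rewrite /L mulrDr addrC lerD2r mulrCA ger_pMr//.
by rewrite ler_pdivrMr// mul1r lerDl.
Qed.

(** The number [s] minus its projection onto the interval [v - e, v + e]. *)
Definition soft_threshold (v e s : R) : R :=
  s - Num.max (v - e) (Num.min s (v + e)).

Lemma soft_threshold_lipschitz v e s t : 0 < e ->
  `|soft_threshold v e s - soft_threshold v e t| <= `|s - t|.
Proof.
move=> e0; wlog st : s t / s <= t.
  move=> H; have [/H//|/ltW/H] := leP s t.
  by rewrite distrC [X in _ <= X]distrC.
rewrite [X in _ <= X]distrC (ger0_norm (_ : 0 <= t - s)) ?subr_ge0//.
rewrite ler_norml /soft_threshold.
by case: (lerP s (v + e)) => ?; case: (lerP t (v + e)) => ?;
  case: (lerP (v - e) _) => ?; try case: (lerP (v - e) _) => ?; lra.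
Qed.

Lemma soft_threshold_eq0 v e s : 0 < e -> `|s - v| <= e ->
  soft_threshold v e s = 0.
Proof.
move=> e0; rewrite ler_distl => /andP[h1 h2].
by rewrite /soft_threshold (min_idPl h2) (max_idPr h1) subrr.
Qed.

Lemma soft_threshold_close v e s : 0 < e ->
  `|soft_threshold v e s - (s - v)| <= e.
Proof.
move=> e0; rewrite /soft_threshold ler_norml.
by case: (lerP s (v + e)) => ?; case: (lerP (v - e) _) => ?; lra.
Qed.

(* The soft threshold of f at the value f p is flat near p, hence locally
   c-Lipschitz there as well; this removes the exceptional points one by one. *)
Lemma lipschitz_near_off_finite (M : completeMetricType R) (c : R)
    (S : seq M) (f : M -> R) :
  approximate_midpoints M -> 0 <= c -> lipschitz_map f ->
  (forall x, x \notin S -> lipschitz_near c f x) ->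
  forall x y, `|f x - f y| <= c * mdist x y.
Proof.
move=> Mmid c0; elim: S f => [|p S IH] f lf fc x y.
  by apply: lipschitz_near_midpoints => // z; exact: fc.
apply/ler_addgt0Pl => e e0; have e2 : 0 < e / 2 by rewrite divr_gt0.
pose h u := soft_threshold (f p) (e / 2) (f u).
have hf u v : `|h u - h v| <= `|f u - f v| by exact: soft_threshold_lipschitz.
(* [h] differs from [f - f p] by at most [e / 2] at each of [x] and [y]. *)
suff : `|h x - h y| <= c * mdist x y.
  have := soft_threshold_close (f p) (f x) e2.
  have := soft_threshold_close (f p) (f y) e2.
  rewrite -/(h x) -/(h y) !ler_norml => /andP[h1 h2] /andP[h3 h4] /andP[h5 h6].
  by apply/andP; split; lra.
apply: IH.
- by case: lf => k fk; exists k => u v; exact: le_trans (hf u v) (fk u v).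
move=> z zS; have [->|zp] := eqVneq z p; last first.
  have [|d d0 fd] := fc z; first by rewrite inE negb_or zp.
  by exists d => // u v zu zv; exact: le_trans (hf u v) (fd _ _ zu zv).
have [k fk] := lf.
have k1 : 0 < `|k| + 1 by rewrite ltr_wpDl.
(* Within this radius of [p], [f] stays within [e / 2] of [f p], so [h] vanishes; [k] itself might
   be zero or negative. *)
exists (e / 2 / (`|k| + 1)); first by rewrite divr_gt0.
have h0 u : mdist p u <= e / 2 / (`|k| + 1) -> h u = 0.
  rewrite ler_pdivlMr// => pu; apply: soft_threshold_eq0 => //.
  apply: le_trans (fk u p) _; rewrite metric_sym mulrC; apply: le_trans pu.
  by rewrite ler_wpM2l ?mdist_ge0// (le_trans (ler_norm k))// lerDl.
by move=> u v /h0 -> /h0 ->; rewrite subrr normr0 mulr_ge0// mdist_ge0.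
Qed.

(** * Length spaces are spreadingly local, and these are local *)

Lemma length_space_spreadingly_local (M : completeMetricType R) :
  (exists x y : M, x <> y) -> length_space M -> spreadingly_local M.
Proof.
move=> Mnt /length_space_midpoints Mmid eps f eps0 lf.
set A := [set x | _]; move=> /finite_seqP[S AS].
have out x : x \notin S -> local_lipschitz_const f x <= lipschitz_const f - eps.
  move=> xS; rewrite leNgt; apply: contra xS => fx.
  by have : A x by []; rewrite AS.
(* The value with [eps / 2] lies strictly above the local constants off [S] and strictly below the
   global one; if nonnegative, it bounds the global one, a contradiction. *)
have [K2|K2] := leP 0 (lipschitz_const f - eps / 2).
  have /(lipschitz_const_le Mnt) : forall x y,
      `|f x - f y| <= (lipschitz_const f - eps / 2) * mdist x y.
    apply: (lipschitz_near_off_finite (S := S)) => // x /out fx.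
    by apply: lipschitz_nearP => //; lra.
  lra.
(* Otherwise nonnegativity of local constants puts all of [M] in the finite list [S]. Then [mdist x]
   is vacuously 0-Lipschitz near the points off [S], hence constant, which is absurd. *)
have MS (x : M) : x \in S.
  apply: contraT => /out; have := local_lipschitz_const_ge0 x lf; lra.
have [x [y xy]] := Mnt.
have xlip : lipschitz_map (mdist x).
  by exists 1 => u v; rewrite mul1r metric_dist_diff.
have xcst z : z \notin S -> lipschitz_near 0 (mdist x) z by rewrite MS.
have := lipschitz_near_off_finite Mmid (lexx 0) xlip xcst x y.
rewrite mul0r mdistxx sub0r normrN ger0_norm ?mdist_ge0//.
by rewrite leNgt mdist_gt0 (introN eqP xy).
Qed.

Lemma spreadingly_local_local (M : metricType R) :
  (exists x y : M, x <> y) -> spreadingly_local M -> local_space M.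
Proof.
move=> Mnt Msl.
have steep (f : M -> R) eps : lipschitz_map f -> 0 < eps ->
    0 < lipschitz_const f -> exists u v : M, [/\ u <> v, mdist u v < eps &
      lipschitz_const f - eps < (f u - f v) / mdist u v].
  (* The minimum keeps [lipschitz_const f - e'] nonnegative, as [lipschitz_const_on_gtP]
     requires. *)
  move=> lf e0 K0; pose e' := Num.min eps (lipschitz_const f).
  have e'0 : 0 < e' by rewrite lt_min e0.
  have e'e : e' <= eps by rewrite ge_min lexx.
  have e'K : e' <= lipschitz_const f by rewrite ge_min lexx orbT.
  have /infinite_setN0 [x /= xe] := Msl _ _ e'0 lf.
  (* Two points of a ball of radius [eps / 3] are at distance at most 2 eps / 3 < eps. *)
  have e3 : 0 < eps / 3 by rewrite divr_gt0.
  have K'0 : 0 <= lipschitz_const f - e' by lra.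
  have [u [v [xu xv uv slope]]] := lipschitz_const_on_gtP K'0
    (lt_le_trans xe (local_lipschitz_const_le x lf e3)).
  exists u, v; split=> //; last lra.
  have := metric_triangle u x v; rewrite /metric_closed_ball /= in xu xv.
  by rewrite (metric_sym u x); lra.
move=> eps f eps0 lf.
have [K0|K0] := ltP 0 (lipschitz_const f); first exact: steep.
(* A constant [f] only asks for two distinct points closer than [eps]; [steep] applied to [mdist x]
   provides them. *)
have fcst u v : f u - f v = 0.
  apply/eqP; rewrite -normr_le0.
  have := lipschitz_const_on_le lf (I : setT u) (I : setT v).
  move=> /le_trans; apply; rewrite mulr_le0_ge0 ?mdist_ge0//.
have [x [y xy]] := Mnt.
have xlip : lipschitz_map (mdist x).
  by exists 1 => u v; rewrite mul1r metric_dist_diff.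
have [|u [v [uv uve _]]] := steep _ _ xlip eps0.
  rewrite ltNge; apply/negP => K0'.
  have := lipschitz_const_on_le xlip (I : setT x) (I : setT y).
  rewrite mdistxx sub0r normrN ger0_norm ?mdist_ge0// leNgt => /negP; apply.
  apply: le_lt_trans (_ : 0 < _); last by rewrite mdist_gt0; apply/eqP.
  by rewrite mulr_le0_ge0 ?mdist_ge0.
exists u, v; split=> //; rewrite fcst mul0r.
have := lipschitz_const_on_ge0 setT lf; rewrite -/(lipschitz_const f); lra.
Qed.

End ApproximateMidpoints.

Theorem proposition2p4 (R : realType) (M : completeMetricType R)
    (M_nontrivial : exists x y : M, x <> y) :
  [<-> length_space M; spreadingly_local M; local_space M].
Proof.
tfae.
- exact: length_space_spreadingly_local.
- exact: spreadingly_local_local.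
- by move=> /local_space_midpoints; exact: midpoints_length_space.
Qed.
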